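(* Let $k$ be a field of characteristic $p>0$, let $f(X)\in k[X]$ be a monic separable additive polynomial of degree $p^n$ whose set of roots $\mathcal{G}_f$ is contained in $k$, and let $K=k(y)$ with $f(y)=u\in k$, where $f(X)-u\in k[X]$ is irreducible. Then the subextensions of $K/k$ of degree $p$ over $k$ are given by $k(z_{\mathcal{H}})$ with $$z_{\mathcal{H}}^p-z_{\mathcal{H}}=\frac{u}{f_{\mathcal{H}}(\varepsilon_{\mathcal{H}})^p},$$ where $\mathcal{H}<\mathcal{G}_f$ is an $\mathbb{F}_p$-subspace of $\mathcal{G}_f$ of codimension $1$, $f_{\mathcal{H}}(X)=\prod_{\delta\in\mathcal{H}}(X-\delta)$, and $\varepsilon_{\mathcal{H}}\in\mathcal{G}_f$ is such that $\mathcal{G}_f=\mathcal{H}+\mathbb{F}_p\varepsilon_{\mathcal{H}}$. Furthermore, $k(z_{\mathcal{H}})$ is the fixed field under $\mathcal{H}$, that is, $k(z_{\mathcal{H}})=K^{\mathcal{H}}$, and $\operatorname{Gal}(k(z_{\mathcal{H}})/k)=\langle\sigma_{\varepsilon_{\mathcal{H}}}\rangle$ where $\sigma_{\varepsilon_{\mathcal{H}}}(y)=y+\varepsilon_{\mathcal{H}}$. Moreover, $\sigma_{\varepsilon_{\mathcal{H}}}(z_{\mathcal{H}})=z_{\mathcal{H}}+1$.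
   Context: A polynomial $f$ is additive if $f(x+y)=f(x)+f(y)$ for all $x,y\in\bar k$. $\mathcal{G}_f=\{\xi\in\bar k\mid f(\xi)=0\}$ is an $\mathbb{F}_p$-vector space of dimension $n$. Under the hypotheses $K/k$ is Galois and $G=\operatorname{Gal}(K/k)$ is identified with $\mathcal{G}_f$ via $\sigma\mapsto\xi_\sigma$, where $\sigma(y)=y+\xi_\sigma$; for $\varepsilon\in\mathcal{G}_f$, $\sigma_\varepsilon\in G$ is the element with $\sigma_\varepsilon(y)=y+\varepsilon$ (and the same symbol denotes its restriction to subextensions). $K^{\mathcal{H}}$ is the fixed field of the subgroup of $G$ corresponding to $\mathcal{H}$ under this identification. *)

(* Defs.v *)
From HB Require Import structures.
From mathcomp Require Import all_boot all_order all_fingroup all_algebra.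
From mathcomp Require Import all_solvable all_field.
From mathcomp Require Import finmap.

Set Implicit Arguments.
Unset Strict Implicit.
Unset Printing Implicit Defensive.

Import GRing.Theory.
Local Open Scope ring_scope.

Definition additive_over (k kbar : fieldType) (iota : {rmorphism k -> kbar})
    (f : {poly k}) : Prop :=
  forall x y : kbar,
    (map_poly iota f).[x + y] = (map_poly iota f).[x] + (map_poly iota f).[y].

Definition roots_in_base (k kbar : fieldType) (iota : {rmorphism k -> kbar})
    (f : {poly k}) : Prop :=
  forall xi : kbar, root (map_poly iota f) xi -> exists c : k, xi = iota c.

(* The \dim of vector.v is available only inside a finite-dimensional ambient
   space, whereas here the ambient space is k, which may be infinite over 'F_p.
   [has_dim S m] forces S to be a linear subspace, being the span of b. *)
Definition has_dim (F : fieldType) (V : lmodType F) (S : {pred V}) (m : nat) :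
    Prop :=
  exists b : 'I_m -> V,
    (forall c : 'I_m -> F, \sum_i c i *: b i = 0 -> forall i, c i = 0) /\
    (forall v : V, v \in S <-> exists c : 'I_m -> F, v = \sum_i c i *: b i).

Definition codim1_subspace (F : fieldType) (V : lmodType F) (S T : {pred V}) :
    Prop :=
  {subset S <= T} /\ exists m : nat, has_dim S m /\ has_dim T m.+1.

Section Hyperplanes.

Variables (p : nat) (k : fieldType) (chk : p \in [pchar k]) (f : {poly k}).

(* k as a vector space over 'F_p *)
Local Notation V := (pPrimeCharType chk).

(* When the roots of f all lie in k, this is the set G_f. *)
Definition Groots : {pred V} := [pred c : V | root f (c : k)].

Definition hyperplane (H : {fset k}) : Prop :=
  codim1_subspace ([pred c : V | (c : k) \in H] : {pred V}) Groots.

Definition complement_vector (H : {fset k}) (e : k) : Prop :=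
  (e : V) \in Groots /\
  (forall x : V, x \in Groots <->
     exists h : k, exists2 c : 'F_p, h \in H & x = (h : V) + c *: (e : V)).

Definition fH (H : {fset k}) : {poly k} := \prod_(d <- H) ('X - d%:P).

End Hyperplanes.

Definition artin_schreier_root (p : nat) (k : fieldType) (L : fieldExtType k)
    (u : k) (H : {fset k}) (e : k) (z : L) : Prop :=
  z ^+ p - z = (u / (fH H).[e] ^+ p)%:A.

(* The part of Gal(K/k) corresponding to H under the identification
   s |-> s y - y of Gal(K/k) with the roots of f. *)
Definition gal_of_roots (k : fieldType) (L : splittingFieldType k)
    (K : {subfield L}) (y : L) (H : {fset k}) : {set gal_of K} :=
  [set s in 'Gal(K / 1%VS)%g | (s y - y) \in [seq d%:A | d <- H]].

(* Main.v *)
Require Import Defs.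
From HB Require Import structures.
From mathcomp Require Import all_boot all_order all_fingroup all_algebra.
From mathcomp Require Import all_solvable all_field.
From mathcomp Require Import finmap.

Set Implicit Arguments.
Unset Strict Implicit.
Unset Printing Implicit Defensive.

Import GRing.Theory.
Local Open Scope ring_scope.

(** The roots of [f] form a finite additive subgroup [G] of [k], and
    [f = fH G] in the notation of the definitions.  The conjugates of [y] are
    then the translates [y + d], [d] in [G], so that [K] is Galois over [k], with
    group isomorphic to [G] by [s |-> s y - y]; in particular this group is
    abelian and every subextension of [K] is Galois over [k].

    Let [H] be a hyperplane of [G], [e] a vector that completes it,
    [W := fH H] and [a := W.[e]].  The polynomial [W (X + c) - W X - W c] has
    degree less than [#|H|] and vanishes on [H], hence [W] is additive
    ([comp_fH_translate]).  It follows that [W ^ p - a ^ (p - 1) W] vanishes on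
    [G], hence equals [f] ([fH_supplement]).  At [y] this says that
    [W y / a] solves the Artin-Schreier equation with constant term
    [u / a ^ p]; the other solutions differ from it by elements of the prime
    field.  Again by additivity, if [s y = y + d] then [s z = z + W d / a] for
    any solution [z] ([gal_artin_schreier]).  So [z] is fixed exactly by the
    [s] with [d] in [H], which identifies [k(z)] with the fixed field of [H]
    ([artin_schreier_fixedField]), while [d = e] translates [z] by 1, which gives
    a generator of the group of [k(z)], of order [p].

    Conversely a subextension [E] of degree [p] is the fixed field of
    [Gal(K / E)], a subgroup of index [p], which corresponds to a subgroup [H] of
    [G] of index [p] ([subfield_hyperplane]).  That such an [H] is a hyperplane
    in the sense of bases is a matter of counting: a finite set closed under the
    linear operations over ['F_p] has a basis, and its cardinal is [p] to its
    dimension ([has_dim_finite], [size_has_dim]). *)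

(** * Finite vector spaces over a finite field *)

Section FiniteSubspaces.

Variables (F : finFieldType) (V : lmodType F).

Let lincomb m (b : 'I_m -> V) (c : {ffun 'I_m -> F}) : V := \sum_i c i *: b i.

Let lincomb_inj m (b : 'I_m -> V) :
    (forall c : 'I_m -> F, \sum_i c i *: b i = 0 -> forall i, c i = 0) ->
  injective (lincomb b).
Proof.
move=> b_free c d eq_cd; apply/ffunP=> i; apply/eqP; rewrite -subr_eq0.
apply/eqP; move: i; apply: b_free.
under eq_bigr => i _ do rewrite scalerBl.
by rewrite sumrB; apply/eqP; rewrite subr_eq0; apply/eqP.
Qed.

Lemma size_has_dim (S : {pred V}) (s : seq V) m :
  uniq s -> s =i S -> has_dim S m -> size s = (#|F| ^ m)%N.
Proof.
move=> s_uniq sS [b [b_free b_span]].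
have inj := lincomb_inj b_free.
suffices /perm_size->: perm_eq s (codom (lincomb b)).
  by rewrite size_codom card_ffun card_ord.
apply: uniq_perm; rewrite // ?(map_inj_uniq inj) ?enum_uniq // => x; rewrite sS.
apply/idP/codomP=> [/b_span[c ->] | [c ->]].
  by exists [ffun i => c i]; apply: eq_bigr => i _; rewrite ffunE.
by apply/b_span; exists c.
Qed.

(** A linearly independent family in [S] that does not span [S] can be extended
    by a vector of [S] outside its span.  This cannot go on forever, since the
    span of [m] independent vectors has [#|F| ^ m] elements. *)
Lemma has_dim_finite (S : {pred V}) (s : seq V) :
    s =i S -> 0 \in S -> {in S &, forall v w, v + w \in S} ->
    (forall a : F, {in S, forall v, a *: v \in S}) ->
  exists m, has_dim S m.
Proof.
move=> sS S0 SD SZ.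
have grow m : (exists m', has_dim S m') \/ exists2 b : 'I_m -> V,
    (forall c : 'I_m -> F, \sum_i c i *: b i = 0 -> forall i, c i = 0) &
    forall i, b i \in S.
  elim: m => [|m [|[b b_free Sb]]]; first by right; exists (fun=> 0) => [c _|] [].
    by left.
  have Slc (c : 'I_m -> F) : \sum_i c i *: b i \in S.
    by apply: (big_ind (fun v => v \in S)) => // i _; apply: SZ.
  case: (boolP (all [in codom (lincomb b)] s)) => [/allP s_span | ].
    left; exists m, b; split=> // v; split=> [| [c ->] //].
    by rewrite -sS => /s_span/codomP[c ->]; exists c.
  case/allPn=> v; rewrite sS => Sv v_span; right.
  exists (fun i => oapp b v (unlift ord0 i)) => [c | i]; last first.
    by case: (unlift _ i) => //=.
  rewrite big_ord_recl unlift_none /=.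
  under eq_bigr => i _ do rewrite liftK /=.
  (* Otherwise dividing by [c ord0] would put [v] in the span of [b]. *)
  move=> c0; have c00 : c ord0 = 0.
    apply: contraNeq v_span => nz_c; apply/codomP.
    exists [ffun i => - (c ord0)^-1 * c (lift ord0 i)]; rewrite /lincomb.
    under eq_bigr => i _ do rewrite ffunE -scalerA.
    rewrite -scaler_sumr scaleNr -scalerN; move/eqP: c0; rewrite addr_eq0.
    by move/eqP<-; rewrite scalerA mulVf ?scale1r.
  move: c0; rewrite c00 scale0r add0r => /b_free c0 i.
  by case: (unliftP ord0 i) => [j|] ->.
have [// | [b b_free Sb]] := grow (size s).+1.
have : (size (codom (lincomb b)) <= size s)%N.
  apply: uniq_leq_size => [|v /codomP[c ->]].
    by rewrite map_inj_uniq ?enum_uniq //; apply: lincomb_inj.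
  by rewrite sS; apply: (big_ind (fun v => v \in S)) => // i _; apply: SZ.
rewrite size_codom card_ffun card_ord leqNgt.
have := ltn_expl (size s).+1 (finNzRing_gt1 F).
by move=> /(ltn_trans (ltnSn _)) ->.
Qed.

End FiniteSubspaces.

(** * The polynomial of a finite additive subgroup *)

(** Closure under opposites is automatic, because the set is finite. *)
Definition additive_fset (k : zmodType) (H : {fset k}) : Prop :=
  0 \in H /\ {in H &, forall a b, a + b \in H}.

Lemma card_additive_fset_gt0 (k : zmodType) (H : {fset k}) :
  additive_fset H -> (0 < #|` H|)%N.
Proof. by case=> H0 _; rewrite cardfs_gt0; apply/fset0Pn; exists 0. Qed.

Lemma additive_fset_Mn (k : zmodType) (H : {fset k}) (e : k) c :
  additive_fset H -> e \in H -> e *+ c \in H.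
Proof.
by case=> H0 HD He; elim: c => [|c IHc]; rewrite ?mulr0n ?mulrS //; apply: HD.
Qed.

(** The leading terms cancel in [q - r], whose degree is then too small for the
    number of its roots. *)
Lemma eq_monic_roots (R : idomainType) (rs : seq R) (q r : {poly R}) :
    uniq rs -> q \is monic -> r \is monic ->
    size q = (size rs).+1 -> size r = (size rs).+1 ->
    {in rs, forall x, q.[x] = r.[x]} ->
  q = r.
Proof.
move=> rs_uniq q_monic r_monic size_q size_r eq_qr.
apply/eqP; rewrite -subr_eq0; apply/eqP.
apply: (@roots_geq_poly_eq0 _ _ rs) => //.
  by apply/allP=> x /eq_qr eq_x; rewrite rootE !hornerE eq_x subrr.
apply/leq_sizeP=> j; rewrite leq_eqVlt => /orP[/eqP<- | lt_j].
  have lead (t : {poly R}) :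
      t \is monic -> size t = (size rs).+1 -> t`_(size rs) = 1.
    by move=> /monicP; rewrite lead_coefE => + sz; rewrite sz.
  by rewrite coefB !lead ?subrr.
by rewrite coefB !nth_default ?subrr ?size_q ?size_r.
Qed.

Section SubspacePolynomial.

Variables (k : fieldType) (H : {fset k}) (addH : additive_fset H).
Local Notation W := (fH H).

Lemma size_fH : size W = #|` H|.+1.
Proof. exact: size_prod_XsubC. Qed.

Lemma monic_fH : W \is monic.
Proof. exact: monic_prod_XsubC. Qed.

Lemma root_fH x : root W x = (x \in H).
Proof. exact: root_prod_XsubC. Qed.

(** Translation by [h] permutes the roots [H] of [fH H]. *)
Lemma horner_fH_shift h x : h \in H -> W.[h + x] = W.[x].
Proof.
move=> Hh; rewrite /fH !horner_prod.
have [_ HH] : (size [seq h + d | d <- H] = size H) * ([seq h + d | d <- H] =i H).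
  apply: uniq_min_size; rewrite ?size_map //.
    by rewrite map_inj_uniq ?fset_uniq //; apply: addrI.
  by move=> _ /mapP[d Hd ->]; apply: addH.2.
have perm_H : perm_eq [seq h + d | d <- H] H.
  by apply: uniq_perm => //; rewrite ?map_inj_uniq ?fset_uniq //; apply: addrI.
rewrite -(perm_big _ perm_H) big_map.
by apply: eq_bigr => d _; rewrite !hornerXsubC opprD addrACA subrr add0r.
Qed.

(** Both sides are monic of degree [#|H|] and take the value [W.[e]] at each
    point of [H].  This polynomial form of the additivity of [W] is what allows
    evaluation at points of an extension of [k]. *)
Lemma comp_fH_translate e : W \Po ('X + e%:P) = W + W.[e]%:P.
Proof.
have size_We : (size W.[e]%:P < size W)%N.
  rewrite size_fH (leq_ltn_trans (size_polyC_leq1 _)) //.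
  exact: card_additive_fset_gt0.
apply: (@eq_monic_roots _ H); rewrite ?fset_uniq //.
- rewrite monicE lead_coef_comp ?size_XaddC // (monicP monic_fH).
  by rewrite lead_coefXaddC expr1n mulr1.
- by rewrite monicE lead_coefDl // (monicP monic_fH).
- by rewrite size_comp_poly2 ?size_fH ?size_XaddC.
- by rewrite size_polyDl // size_fH.
move=> h Hh; rewrite horner_comp !hornerE horner_fH_shift //.
by rewrite (rootP (_ : root W h)) ?root_fH // add0r.
Qed.

Lemma horner_fHD x e : W.[x + e] = W.[x] + W.[e].
Proof.
have := congr1 (horner^~ x) (comp_fH_translate e).
by rewrite horner_comp !hornerE.
Qed.

Lemma horner_fHMn e c : W.[e *+ c] = W.[e] *+ c.
Proof.
elim: c => [|c IHc]; last by rewrite !mulrS horner_fHD IHc.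
by rewrite !mulr0n; apply/rootP; rewrite root_fH; apply: addH.1.
Qed.

Lemma horner_fH_in_alg (L : fieldExtType k) (x : L) (e : k) :
  (map_poly (in_alg L) W).[x + e%:A] = (map_poly (in_alg L) W).[x] + W.[e]%:A.
Proof.
have := congr1 (map_poly (in_alg L)) (comp_fH_translate e).
rewrite map_comp_poly !rmorphD /= map_polyX !map_polyC /=.
by move/(congr1 (horner^~ x)); rewrite horner_comp !hornerE.
Qed.

End SubspacePolynomial.

(** Multiples [e *+ c] by naturals, as they avoid any reference to the structure
    of [k] over its prime field. *)
Definition supplements (k : zmodType) (G H : {fset k}) (e : k) : Prop :=
  forall x, x \in G <-> exists2 h, h \in H & exists c : nat, x = h + e *+ c.

(** Put [W := fH H] and [a := W.[e]].  By additivity [W] maps [h + e *+ c] to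
    [a *+ c], a root of [X ^+ p - a ^+ p.-1 * X]; so the right-hand side vanishes
    on [G], and it is monic of degree [#|G|]. *)
Lemma fH_supplement (p : nat) (k : fieldType) (chk : p \in [pchar k])
    (G H : {fset k}) (e : k) :
    additive_fset H -> supplements G H e -> #|` G| = (p * #|` H|)%N ->
  fH G = fH H ^+ p - (fH H).[e] ^+ p.-1 *: fH H.
Proof.
move=> addH supp cardG; have p_pr := pcharf_prime chk.
have H_gt0 := card_additive_fset_gt0 addH.
have sizeWp : size (fH H ^+ p) = #|` G|.+1.
  rewrite -[LHS]prednK ?size_exp ?size_fH /= ?cardG 1?mulnC //.
  by rewrite lt0n size_poly_eq0 expf_neq0 ?monic_neq0 ?monic_fH.
have size_lt : (size (- ((fH H).[e] ^+ p.-1 *: fH H)) < size (fH H ^+ p))%N.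
  rewrite size_polyN sizeWp (leq_ltn_trans (size_scale_leq _ _)) //.
  by rewrite size_fH ltnS cardG ltn_Pmull ?prime_gt1.
apply: (@eq_monic_roots _ G); rewrite ?fset_uniq ?monic_fH //.
- by rewrite monicE lead_coefDl // (monicP (monic_exp _ (monic_fH _))).
- by rewrite size_fH.
- by rewrite size_polyDl.
move=> x Gx; have [h Hh [c ->]] := (supp x).1 Gx.
rewrite (rootP (_ : root (fH G) _)); last first.
  by rewrite root_fH; apply/supp; exists h => //; exists c.
rewrite !hornerE horner_fHD // horner_fHMn //.
rewrite (rootP (_ : root _ h)) ?root_fH // add0r.
rewrite -(pFrobenius_autE chk) pFrobenius_autMn pFrobenius_autE.
by rewrite mulrnAr -exprSr prednK ?prime_gt0 // subrr.
Qed.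

Lemma horner_fH_neq0 (k : fieldType) (G H : {fset k}) (e : k) :
    additive_fset H -> supplements G H e -> (#|` H| < #|` G|)%N ->
  (fH H).[e] != 0.
Proof.
move=> addH supp ltHG; rewrite -rootE root_fH; apply: contraTN ltHG => He.
rewrite -leqNgt fsubset_leq_card //; apply/fsubsetP=> x /supp[h Hh [c ->]].
by apply: addH.2; rewrite ?additive_fset_Mn.
Qed.

(** * Artin-Schreier equations *)

Lemma natr_lt_pchar_inj (R : idomainType) (p : nat) (chR : p \in [pchar R]) :
  {in gtn p &, injective (fun c : nat => c%:R : R)}.
Proof.
move=> c d; wlog le_cd : c d / (c <= d)%N.
  move=> W c_lt d_lt eq_cd; case/orP: (leq_total c d) => le_cd; first exact: W.
  exact/esym/W.
rewrite !inE => _ d_lt eq_cd.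
have : (d - c)%:R == 0 :> R by rewrite natrB // eq_cd subrr.
rewrite -(dvdn_pcharf chR) => /dvdn_leq le_p; apply/eqP; rewrite eqn_leq le_cd /=.
rewrite -subn_eq0; apply: contraTT d_lt; rewrite -lt0n => /le_p le_pd.
by rewrite -leqNgt (leq_trans le_pd) ?leq_subr.
Qed.

(** ['X^p - 'X] already has the [p] roots [c%:R], [c < p]. *)
Lemma Frobenius_fixed (F : fieldType) (p : nat) (chF : p \in [pchar F]) (w : F) :
  w ^+ p = w -> exists c : nat, w = c%:R.
Proof.
move=> wp; have p_pr := pcharf_prime chF.
pose rs : seq F := [seq c%:R | c <- iota 0 p].
have rs_uniq : uniq rs.
  rewrite map_inj_in_uniq ?iota_uniq // => c d; rewrite !mem_iota !add0n /=.
  exact: natr_lt_pchar_inj.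
suffices /mapP[c _ ->] : w \in rs by exists c.
have size_P : size ('X^p - 'X : {poly F}) = p.+1.
  by rewrite size_polyDl size_polyXn // size_polyN size_polyX ltnS prime_gt1.
have P_neq0 : 'X^p - 'X != 0 :> {poly F} by rewrite -size_poly_eq0 size_P.
apply: contraT => w_notin.
have := @max_poly_roots _ _ (w :: rs) P_neq0.
rewrite size_P /= size_map size_iota ltnn w_notin rs_uniq.
rewrite rootE !hornerE wp subrr eqxx.
move=> /(_ _ isT)-> //; apply/allP=> _ /mapP[c _ ->].
by rewrite rootE !hornerE -(pFrobenius_autE chF) pFrobenius_aut_nat subrr.
Qed.

Lemma artin_schreier_solutions (F : fieldType) (p : nat) (chF : p \in [pchar F])
    (v w : F) :
  w ^+ p - w = v ^+ p - v -> exists c : nat, w = v + c%:R.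
Proof.
move=> eq_vw; have [|c Dc] := @Frobenius_fixed _ _ chF (w - v); last first.
  by exists c; rewrite -Dc addrC subrK.
rewrite -(pFrobenius_autE chF) rmorphB /= !pFrobenius_autE.
have ->: w ^+ p = w + (v ^+ p - v) by rewrite -eq_vw addrC subrK.
by rewrite -addrA addrAC subrr sub0r.
Qed.

(** * The Galois group acts on y by translations *)

Section Translations.

Variables (k : fieldType) (L : splittingFieldType k) (G : {fset k}) (u : k).
Variable y : L.
Hypotheses (addG : additive_fset G) (irr : irreducible_poly (fH G - u%:P)).
Hypothesis fy : (map_poly (in_alg L) (fH G)).[y] = u%:A.

Local Notation K := <<1; y>>%AS.
Local Notation M := (map_poly (in_alg L) (fH G - u%:P)).

Let size_u : (size (- u%:P) < size (fH G))%N.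
Proof.
rewrite size_polyN size_fH ltnS (leq_trans (size_polyC_leq1 _)) //.
exact: card_additive_fset_gt0.
Qed.

Let M_monic : M \is monic.
Proof. by rewrite map_monic monicE lead_coefDl // (monicP (monic_fH _)). Qed.

Let translates_uniq : uniq [seq y + d%:A | d <- G].
Proof.
by rewrite map_inj_uniq ?fset_uniq // => c d /addrI/(fmorph_inj (in_alg L)).
Qed.

Let M_splits : M = \prod_(x <- [seq y + d%:A | d <- G]) ('X - x%:P).
Proof.
apply: (@eq_monic_roots _ [seq y + d%:A | d <- G]) => //.
- exact: monic_prod_XsubC.
- by rewrite size_map_poly size_polyDl // size_fH size_map.
- by rewrite size_prod_XsubC.
move=> x xG; rewrite [RHS](rootP _) ?root_prod_XsubC //.
case/mapP: xG => d Gd ->.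
rewrite rmorphB /= map_polyC !hornerE horner_fH_in_alg // fy.
by rewrite (rootP (_ : root (fH G) d)) ?root_fH // scale0r addr0 subrr.
Qed.

Let root_M x : root M x = (x \in [seq y + d%:A | d <- G]).
Proof. by rewrite M_splits root_prod_XsubC. Qed.

Let y_translate : y \in [seq y + d%:A | d <- G].
Proof. by apply/mapP; exists 0; rewrite ?scale0r ?addr0 //; apply: addG.1. Qed.

(** [M] is irreducible over the base field and vanishes at [y]. *)
Lemma minPoly_translates :
  minPoly 1 y = \prod_(x <- [seq y + d%:A | d <- G]) ('X - x%:P).
Proof.
rewrite -M_splits; apply/eqP; rewrite -eqp_monic ?monic_minPoly //.
have minPoly_dvd : minPoly 1 y %| M.
  by apply: minPoly_dvdp; rewrite ?root_M //; apply/polyOver1P; eexists.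
have [q Dq] := polyOver1P (minPolyOver 1 y).
rewrite Dq dvdp_map in minPoly_dvd *.
rewrite eqp_map irr.2 // -(size_map_poly (in_alg L)) -Dq size_minPoly.
by rewrite eqSS -lt0n.
Qed.

Lemma galois_translates : galois 1 K.
Proof.
apply/splitting_galoisField; exists M; split.
- by apply/polyOver1P; eexists.
- by rewrite M_splits separable_prod_XsubC.
exists [seq y + d%:A | d <- G]; first by rewrite M_splits eqpxx.
apply/eqP; rewrite eqEsubv; apply/andP; split.
  apply/Fadjoin_seqP; rewrite sub1v; split=> // _ /mapP[d _ ->].
  by rewrite rpredD ?memv_adjoin // rpredZ ?mem1v.
by apply/FadjoinP; rewrite sub1v seqv_sub_adjoin.
Qed.

Lemma dim_translates : \dim K = #|` G|.
Proof.
rewrite dim_Fadjoin dimv1 muln1; apply: succn_inj.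
by rewrite -size_minPoly minPoly_translates size_prod_XsubC size_map.
Qed.

Lemma gal_translate (s : gal_of K) :
  s \in 'Gal(K / 1)%g -> exists2 d, d \in G & s y = y + d%:A.
Proof.
move=> galKs; have := root_minPoly_gal (sub1v _) galKs (memv_adjoin 1 y).
by rewrite minPoly_translates root_prod_XsubC => /mapP[d Gd ->]; exists d.
Qed.

Lemma translate_gal d :
  d \in G -> exists2 s : gal_of K, s \in 'Gal(K / 1)%g & s y = y + d%:A.
Proof.
move=> Gd; apply: (normalField_root_minPoly (sub1v _)); rewrite ?memv_adjoin //.
  by case/and3P: galois_translates.
by rewrite minPoly_translates root_prod_XsubC; apply/mapP; exists d.
Qed.

Lemma gal_scalar (E : {subfield L}) (s : gal_of E) (a : k) : s a%:A = a%:A.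
Proof. exact: (rmorph_alg s). Qed.

Lemma gal_horner_fH (E : {subfield L}) (s : gal_of E) (H : {fset k}) (x : L) :
  s (map_poly (in_alg L) (fH H)).[x] = (map_poly (in_alg L) (fH H)).[s x].
Proof.
rewrite -horner_map; congr _.[_]; rewrite -map_poly_comp.
by apply: eq_map_poly => a /=; apply: gal_scalar.
Qed.

Lemma galM_translate (s t : gal_of K) c d :
  s y = y + c%:A -> t y = y + d%:A -> (s * t)%g y = y + (c + d)%:A.
Proof.
move=> sy ty; rewrite galM ?memv_adjoin // sy rmorphD /= ty gal_scalar.
by rewrite scalerDl addrA (addrAC y).
Qed.

Lemma abelian_translates : abelian 'Gal(K / 1)%g.
Proof.
apply/centsP=> s galKs t galKt; apply/eqP.
have [[c Gc sy] [d Gd ty]] := (gal_translate galKs, gal_translate galKt).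
rewrite gal_adjoin_eq ?groupM // (galM_translate sy ty) (galM_translate ty sy).
by rewrite [c + d]addrC.
Qed.

(** Every subgroup of an abelian group is normal. *)
Lemma subfield_galois (E : {subfield L}) : (E <= K)%VS -> galois 1 E.
Proof.
move=> sEK; have galEK := galoisS (_ : (1 <= E <= K)%VS) galois_translates.
rewrite sub1v sEK in galEK; rewrite -(galois_fixedField (galEK isT)).
apply: normal_fixedField_galois galois_translates _ _.
by rewrite -sub_abelian_normal ?abelian_translates // galS ?sub1v.
Qed.

End Translations.

(** * The degree p subextension attached to a hyperplane *)

Section ArtinSchreier.

Variables (p : nat) (k : fieldType) (chk : p \in [pchar k]).
Variables (L : splittingFieldType k) (G H : {fset k}) (u e : k) (y : L).
Hypotheses (addG : additive_fset G) (addH : additive_fset H).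
Hypotheses (supp : supplements G H e) (cardG : #|` G| = (p * #|` H|)%N).
Hypothesis irr : irreducible_poly (fH G - u%:P).
Hypothesis fy : (map_poly (in_alg L) (fH G)).[y] = u%:A.

Local Notation K := <<1; y>>%AS.
Local Notation a := (fH H).[e].
Local Notation Wy := (map_poly (in_alg L) (fH H)).[y].

Let p_pr : prime p. Proof. exact: pcharf_prime chk. Qed.

Let chL : p \in [pchar L].
Proof. by rewrite (fmorph_pchar (in_alg L)). Qed.

Let a_neq0 : a != 0.
Proof.
apply: horner_fH_neq0 supp _ => //.
by rewrite cardG ltn_Pmull ?prime_gt1 ?card_additive_fset_gt0.
Qed.

(** Evaluating [fH_supplement] at [y] gives [Wy ^+ p - a ^+ p.-1 * Wy = u]; divide
    by [a ^+ p]. *)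
Lemma artin_schreier_quotient : artin_schreier_root p u H e (a^-1 *: Wy).
Proof.
rewrite /artin_schreier_root exprZn.
have := fy; rewrite (fH_supplement chk addH supp cardG).
rewrite rmorphB rmorphXn /= linearZ /= !hornerE => /(congr1 ( *:%R (a ^- p))).
rewrite scalerBr exprVn => eq_y.
have ->: (u / a ^+ p)%:A = a ^- p *: u%:A :> L by rewrite scalerA mulrC.
rewrite -eq_y -scalerAl mul1r scalerA; congr (_ - _ *: _).
rewrite -[in a ^- p](prednK (prime_gt0 p_pr)) exprS invfM -mulrA.
by rewrite mulVf ?mulr1 ?expf_neq0.
Qed.

Variable z : L.
Hypothesis ASz : artin_schreier_root p u H e z.

Lemma artin_schreier_roots_differ : exists c : nat, z = a^-1 *: Wy + c%:R.
Proof.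
by apply: (artin_schreier_solutions chL); rewrite ASz artin_schreier_quotient.
Qed.

(** Additivity of [W] turns the translation of [y] by [d] into one of [z], which
    is trivial exactly when [d] lies in [H]. *)
Lemma gal_artin_schreier (s : gal_of K) d :
  s y = y + d%:A -> s z = z + ((fH H).[d] / a)%:A.
Proof.
move=> sy; have [c ->] := artin_schreier_roots_differ.
rewrite rmorphD rmorph_nat /= linearZ /= gal_horner_fH sy horner_fH_in_alg //.
by rewrite scalerDr scalerA [a^-1 * _]mulrC addrAC.
Qed.

Lemma artin_schreier_sub : (<<1; z>> <= K)%VS.
Proof.
have [c ->] := artin_schreier_roots_differ.
apply/FadjoinP; rewrite sub1v; split=> //.
rewrite rpredD ?rpredMn ?rpred1 // rpredZ //.
rewrite rpred_horner ?memv_adjoin //; apply: polyOverS (subvP (sub1v _)) _ _.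
by apply/polyOver1P; eexists.
Qed.

(** An element of the Galois group fixes [z] exactly when it translates [y] by an
    element of [H]; so the Galois correspondence gives both inclusions. *)
Lemma artin_schreier_fixedField : <<1; z>>%VS = fixedField (gal_of_roots K y H).
Proof.
have galK : galois <<1; z>>%AS K.
  have sE : (1 <= <<1; z>> <= K)%VS by rewrite sub1v artin_schreier_sub.
  exact: galoisS sE (galois_translates addG fy).
apply/eqP; rewrite eqEsubv; apply/andP; split.
  apply/FadjoinP; rewrite sub1v; split=> //.
  apply/fixedFieldP; first exact: (FadjoinP artin_schreier_sub).2.
  move=> s; rewrite inE => /andP[_ /mapP[d Hd /eqP]].
  rewrite subr_eq addrC => /eqP/gal_artin_schreier->.
  by rewrite (rootP (_ : root (fH H) d)) ?root_fH // mul0r scale0r addr0.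
rewrite -[X in (_ <= X)%VS](galois_fixedField galK); apply: fixedFieldS.
apply/subsetP=> s galKs; have galKs1 := subsetP (galS _ (sub1v _)) _ galKs.
have [d Gd sy] := gal_translate addG irr fy galKs1.
rewrite inE galKs1 sy addrC addKr; apply/mapP; exists d => //.
have := fixed_gal artin_schreier_sub galKs (memv_adjoin _ _).
move/eqP; rewrite (gal_artin_schreier sy) -subr_eq0 addrC addKr.
rewrite scaler_eq0 oner_eq0 orbF mulf_eq0 invr_eq0 (negPf a_neq0) orbF.
by rewrite -rootE root_fH.
Qed.

Lemma artin_schreier_galois : galois 1 <<1; z>>.
Proof. exact: subfield_galois irr fy _ artin_schreier_sub. Qed.

Let E_normal : normalField 1 <<1; z>>.
Proof. by case/and3P: artin_schreier_galois. Qed.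

Section Generator.

Variable s : gal_of K.
Hypotheses (galKs : s \in 'Gal(K / 1)%g) (sy : s y = y + e%:A).
Local Notation t := (normalField_cast <<1; z>>%AS s).

Lemma gal_artin_schreier_gen : s z = z + 1.
Proof. by rewrite (gal_artin_schreier sy) divff ?a_neq0 // scale1r. Qed.

Let tz : t z = z + 1.
Proof.
rewrite -gal_artin_schreier_gen.
rewrite (normalField_cast_eq _ E_normal galKs) ?memv_adjoin //.
by rewrite sub1v artin_schreier_sub.
Qed.

Let galEt : t \in 'Gal(<<1; z>> / 1)%g.
Proof.
have sE : (1 <= <<1; z>> <= K)%VS by rewrite sub1v artin_schreier_sub.
rewrite -(normalField_img (galois_translates addG fy) sE E_normal).
by apply: mem_morphim.
Qed.

Let tXz c : (t ^+ c)%g z = z + c%:R.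
Proof.
elim: c => [|c IHc]; first by rewrite expg0 gal_id addr0.
by rewrite expgSr galM ?memv_adjoin // IHc rmorphD rmorph_nat /= tz -addrA -mulrS.
Qed.

(** The conjugates of [z] are among the [z + c%:R], which the powers of [t] reach. *)
Lemma artin_schreier_gal : 'Gal(<<1; z>> / 1)%g = <[t]>%g.
Proof.
apply/eqP; rewrite eqEsubset cycle_subG galEt andbT; apply/subsetP=> r galEr.
have [|c Dc] :=
  artin_schreier_solutions chL (_ : (r z) ^+ p - r z = z ^+ p - z).
  by rewrite -rmorphXn -rmorphB ASz; apply: gal_scalar.
by apply/cycleP; exists c; apply/eqP; rewrite gal_adjoin_eq ?groupX // tXz -Dc.
Qed.

Lemma dim_artin_schreier : \dim <<1; z>> = p.
Proof.
have := galois_dim artin_schreier_galois; rewrite dimv1 divn1 => ->.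
rewrite artin_schreier_gal; apply: nt_prime_order => //.
  apply/eqP; rewrite gal_adjoin_eq ?groupX ?group1 // tXz gal_id.
  by rewrite (pcharf0 chL) addr0.
by rewrite gal_adjoin_eq ?group1 // tz gal_id -subr_eq0 addrC addKr oner_eq0.
Qed.

End Generator.

End ArtinSchreier.

(** * Hyperplanes of the space of roots *)

(** The roots of [f] all come from [k], and separability makes them distinct. *)
Lemma additive_split_fH (k kbar : fieldType) (iota : {rmorphism k -> kbar})
    (f : {poly k}) (r : seq kbar) :
    f \is monic -> separable_poly f -> additive_over iota f ->
    roots_in_base iota f ->
    map_poly iota f = \prod_(x <- r) ('X - x%:P) ->
  exists2 G : {fset k}, additive_fset G & f = fH G.
Proof.
move=> f_monic f_sep f_add f_roots Df.
have [s Dr] : exists s, r = map iota s.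
  have {}f_roots x : x \in r -> exists c, x = iota c.
    by move=> rx; apply: f_roots; rewrite Df root_prod_XsubC.
  elim: r f_roots {Df} => [|x r IHr] r_base; first by exists [::].
  have [c ->] := r_base x (mem_head _ _).
  have [|s ->] := IHr; last by exists (c :: s).
  by move=> z rz; apply: r_base; rewrite inE rz orbT.
have {}Df : f = \prod_(c <- s) ('X - c%:P).
  apply: (map_poly_inj iota); rewrite Df Dr big_map rmorph_prod /=.
  by apply: eq_bigr => c _; rewrite map_polyXsubC.
have s_uniq : uniq s by rewrite -separable_prod_XsubC -Df.
pose G : {fset k} := [fset c in s]%fset.
have DG : f = fH G.
  rewrite Df /fH; apply: perm_big; apply: uniq_perm; rewrite ?fset_uniq // => c.
  by rewrite !inE.
have f_addk a b : f.[a + b] = f.[a] + f.[b].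
  apply: (fmorph_inj iota); rewrite rmorphD -!horner_map /= rmorphD.
  exact: f_add.
exists G => //; split.
  rewrite -root_fH -DG; apply/eqP/(addrI f.[0]).
  by rewrite -f_addk !addr0.
move=> a b; rewrite -!root_fH -DG => /rootP fa /rootP fb.
by rewrite rootE f_addk fa fb addr0.
Qed.

Section Hyperplanes.

Variables (p : nat) (k : fieldType) (chk : p \in [pchar k]) (G : {fset k}).
Hypothesis addG : additive_fset G.

Local Notation V := (pPrimeCharType chk).
Local Notation vset A := ([pred c : V | (c : k) \in A] : {pred V}).

Let p_pr : prime p. Proof. exact: pcharf_prime chk. Qed.

Let scale_Fp (c : 'F_p) (x : V) : c *: x = x *+ c.
Proof. by rewrite -[c in LHS]natr_Zp scaler_nat. Qed.

Let card_has_dim (A : {fset k}) m : has_dim (vset A) m -> #|` A| = (p ^ m)%N.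
Proof.
move=> dimA; rewrite -[in RHS](card_Fp p_pr).
exact: (@size_has_dim _ V (vset A) A m (fset_uniq A) (fun _ => erefl) dimA).
Qed.

Let additive_has_dim (A : {fset k}) m : has_dim (vset A) m -> additive_fset A.
Proof.
case=> b [_ b_span]; split=> [|v w /b_span[c Dv] /b_span[d Dw]]; apply/b_span.
  by exists (fun _ => 0); rewrite big1 // => i _; rewrite scale0r.
exists (fun i => c i + d i); rewrite Dv Dw -big_split.
by apply: eq_bigr => i _; rewrite scalerDl.
Qed.

Let has_dim_additive (A : {fset k}) :
  additive_fset A -> exists m, has_dim (vset A) m.
Proof.
move=> addA; apply: (@has_dim_finite _ V (vset A) A) => //.
- exact: addA.1.
- exact: addA.2.
by move=> c v Av; rewrite scale_Fp; apply: additive_fset_Mn.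
Qed.

Let GrootsE : @Groots p k chk (fH G) =i vset G.
Proof. by move=> x; apply: root_fH. Qed.

Let has_dim_eq (S T : {pred V}) m : S =i T -> has_dim S m -> has_dim T m.
Proof.
move=> eqST [b [b_free b_span]]; exists b; split=> // v.
by rewrite -eqST; apply: b_span.
Qed.

(** A finite subspace over ['F_p] of dimension [m] has [p ^ m] elements, so that
    the codimension can be read off from the cardinals. *)
Lemma hyperplaneP (H : {fset k}) :
  hyperplane chk (fH G) H <->
  [/\ additive_fset H, {subset H <= G} & #|` G| = (p * #|` H|)%N].
Proof.
split=> [[sHG [m [dimH /(has_dim_eq GrootsE) dimG]]] | [addH sHG cardG]].
  split; first exact: additive_has_dim dimH.
    by move=> x /sHG; rewrite GrootsE.
  by rewrite (card_has_dim dimH) (card_has_dim dimG) expnS.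
split; first by move=> x /sHG; rewrite -GrootsE.
have [m dimH] := has_dim_additive addH; have [m' dimG] := has_dim_additive addG.
exists m; split=> //; apply: (has_dim_eq (fun x => esym (GrootsE x))).
suffices <- : m' = m.+1 by [].
move/eqP: cardG; rewrite (card_has_dim dimH) (card_has_dim dimG) -expnS.
by rewrite eqn_exp2l ?prime_gt1 // => /eqP.
Qed.

Lemma complement_vectorP (H : {fset k}) (e : k) :
  additive_fset H ->
  complement_vector chk (fH G) H e <-> supplements G H e.
Proof.
move=> addH; split=> [[_ supp] x | supp].
  rewrite -[x \in G]GrootsE; split=> [/supp[h [c Hh ->]] | [h Hh [c ->]]].
    by exists h => //; exists c; rewrite scale_Fp.
  by apply/supp; exists h; exists c%:R; rewrite ?scaler_nat.
split.
  rewrite GrootsE; apply/supp; exists 0; first exact: addH.1.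
  by exists 1%N; rewrite add0r.
move=> x; rewrite GrootsE; split=> [/supp[h Hh [c ->]] | [h [c Hh ->]]].
  by exists h; exists c%:R; rewrite ?scaler_nat.
by apply/supp; exists h => //; exists c; rewrite scale_Fp.
Qed.

(** Any [e] in [G] outside [H] will do: [fH H] does not vanish at [e], so it
    separates the [p] cosets [H + e *+ c], which fill [G] by counting. *)
Lemma supplement_exists (H : {fset k}) :
    additive_fset H -> {subset H <= G} -> #|` G| = (p * #|` H|)%N ->
  exists e, supplements G H e.
Proof.
move=> addH sHG cardG.
have H_gt0 := card_additive_fset_gt0 addH.
have /fsubsetPn[e Ge nHe] : ~~ (G `<=` H)%fset.
  by apply/negP=> /fsubset_leq_card; rewrite cardG leqNgt ltn_Pmull ?prime_gt1.
have nzWe : (fH H).[e] != 0 by rewrite -rootE root_fH.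
pose s := [seq h + e *+ c | h <- H, c <- iota 0 p].
have horner_s h c : h \in H -> (fH H).[h + e *+ c] = (fH H).[e] * c%:R.
  move=> Hh; rewrite horner_fHD // horner_fHMn // mulr_natr.
  by rewrite (rootP (_ : root _ h)) ?root_fH // add0r.
have s_uniq : uniq s.
  apply: allpairs_uniq; rewrite ?fset_uniq ?iota_uniq //.
  move=> _ _ /allpairsP[[h c] [Hh c_lt ->]] /allpairsP[[h' c'] [Hh' c'_lt ->]] /=.
  rewrite !mem_iota in Hh c_lt Hh' c'_lt * => eq_hc.
  have eq_c : c = c'.
    apply: (natr_lt_pchar_inj chk) => //; apply: (mulfI nzWe).
    by rewrite -(horner_s h) // -(horner_s h') // eq_hc.
  by move: eq_hc; rewrite eq_c => /addIr->.
have sG : {subset s <= G}.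
  move=> _ /allpairsP[[h c] [/= /sHG Gh _ ->]].
  by apply: addG.2; rewrite ?additive_fset_Mn.
have [_ sE] : (size s = size G) * (s =i G).
  by apply: uniq_min_size; rewrite // size_allpairs size_iota cardG mulnC.
exists e => x; rewrite -sE; split=> [/allpairsP[[h c] [/= Hh _ ->]] | [h Hh [c ->]]].
  by exists h => //; exists c.
by rewrite sE; apply: addG.2; [apply: sHG | apply: additive_fset_Mn].
Qed.

End Hyperplanes.

(** * Subextensions of degree p *)

(** [H] consists of the translations of [y] realised by [Gal(K / E)]; it has as
    many elements as this group, which has index [p]. *)
Lemma subfield_hyperplane (p : nat) (k : fieldType) (L : splittingFieldType k)
    (G : {fset k}) (u : k) (y : L) (E : {subfield L}) :
    additive_fset G -> irreducible_poly (fH G - u%:P) ->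
    (map_poly (in_alg L) (fH G)).[y] = u%:A ->
    (E <= <<1; y>>)%VS -> \dim E = p ->
  exists H : {fset k}, [/\ additive_fset H, {subset H <= G},
    #|` G| = (p * #|` H|)%N &
    gal_of_roots <<1; y>>%AS y H = 'Gal(<<1; y>> / E)%g].
Proof.
move=> addG irr fy sEK dimE; set K := <<1; y>>%AS.
have galK1 : galois 1 K := galois_translates addG fy.
have galEK : galois E K by apply: galoisS galK1; rewrite sub1v.
pose H : {fset k} :=
  [fset d in G | [exists s in 'Gal(K / E)%g, s y == y + d%:A]%R]%fset.
have HP d : reflect
    (exists2 s : gal_of K, s \in 'Gal(K / E)%g & s y = y + d%:A) (d \in H).
  apply: (iffP idP) => [|[s galEs sy]].
    by rewrite !inE => /andP[_ /exists_inP[s galEs /eqP sy]]; exists s.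
  rewrite !inE; apply/andP; split; last by apply/exists_inP; exists s; rewrite ?sy.
  have [c Gc] := gal_translate addG irr fy (subsetP (galS _ (sub1v _)) _ galEs).
  by rewrite sy => /addrI/(fmorph_inj (in_alg L))->.
have sHG : {subset H <= G} by move=> d; rewrite !inE => /andP[].
have root_inj : {in 'Gal(K / E)%g &, injective (fun s : gal_of K => s y - y)}.
  move=> s t galEs galEt /addIr eq_y; apply/eqP.
  by rewrite gal_adjoin_eq ?eq_y // (subsetP (galS _ (sub1v E))).
have mem_root (s : gal_of K) : s \in 'Gal(K / 1)%g ->
    (s y - y \in [seq d%:A | d <- H]) = (s \in 'Gal(K / E)%g).
  move=> galKs; apply/mapP/idP=> [[d /HP[t galEt ty] sy] | galEs].
    suffices -> : s = t by [].
    have galKt := subsetP (galS _ (sub1v E)) _ galEt.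
    apply/eqP; rewrite gal_adjoin_eq // ty.
    by rewrite -sy addrC subrK.
  have [d _ sy] := gal_translate addG irr fy galKs.
  by exists d; [apply/HP; exists s | rewrite sy addrC addKr].
exists H; split=> //.
- split=> [|c d /HP[s galEs sy] /HP[t galEt ty]]; apply/HP.
    by exists 1%g; rewrite ?group1 // gal_id scale0r addr0.
  by exists (s * t)%g; rewrite ?groupM // (galM_translate sy ty).
- rewrite -(dim_translates addG irr fy) -dimE mulnC.
  suffices -> : #|` H| = #|'Gal(K / E)%g|.
    by rewrite -(galois_dim galEK) divnK ?field_dimS.
  rewrite -(size_map (in_alg L)) cardE.
  rewrite -(size_map (fun s : gal_of K => s y - y)).
  apply/perm_size/uniq_perm.
  + by rewrite map_inj_uniq ?fset_uniq //; apply: fmorph_inj.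
  + by rewrite map_inj_in_uniq ?enum_uniq // => s t; rewrite !mem_enum; apply: root_inj.
  move=> x; apply/mapP/mapP=> [[d /HP[s galEs sy] ->] | [s]].
    by exists s; rewrite ?mem_enum // sy addrC addKr.
  rewrite mem_enum => galEs ->; have galKs := subsetP (galS _ (sub1v E)) _ galEs.
  by have := mem_root s galKs; rewrite galEs => /mapP.
apply/setP=> s; rewrite inE.
case: (boolP (s \in 'Gal(K / 1)%g)) => [/mem_root-> // | ].
by move/(contraNF (subsetP (galS _ (sub1v E)) s)).
Qed.

(** * Description of the subextensions of degree p *)

Theorem theorem5p5 (p n : nat) (k : fieldType) (chk : p \in [pchar k])
    (kbar : closedFieldType) (iota : {rmorphism k -> kbar})
    (kbar_alg : forall x : kbar, algebraicOver iota x)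
    (f : {poly k}) (f_monic : f \is monic) (f_sep : separable_poly f)
    (f_add : additive_over iota f) (f_deg : size f = (p ^ n).+1)
    (f_roots : roots_in_base iota f)
    (u : k) (fu_irr : irreducible_poly (f - u%:P))
    (L : splittingFieldType k) (y : L)
    (fy : (map_poly (in_alg L) f).[y] = u%:A)
    (K : {subfield L}) (K_def : (K : {vspace L}) = <<1; y>>%VS) :
  galois 1 K /\
  (forall E : {subfield L},
     (E <= K)%VS /\ \dim E = p <->
     exists (H : {fset k}) (e : k) (z : L),
       [/\ hyperplane chk f H, complement_vector chk f H e,
           artin_schreier_root p u H e z &
           (E : {vspace L}) = <<1; z>>%VS]) /\
  (forall H : {fset k}, hyperplane chk f H ->
     (exists e : k, complement_vector chk f H e) /\
     (forall e : k, complement_vector chk f H e ->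
        (exists z : L, artin_schreier_root p u H e z) /\
        (forall z : L, artin_schreier_root p u H e z ->
           [/\ <<1; z>>%VS = fixedField (gal_of_roots K y H),
               galois 1 <<1; z>> &
               exists s : gal_of K,
                 [/\ s \in 'Gal(K / 1%VS)%g, s y = y + e%:A,
                     'Gal(<<1; z>> / 1%VS)%g
                       = <[normalField_cast <<1; z>>%AS s]>%g &
                     s z = z + 1]]))).
Proof.
have [r] := closed_field_poly_normal (map_poly iota f).
rewrite (monicP _) ?map_monic // scale1r => Df.
have [G addG DG] := additive_split_fH f_monic f_sep f_add f_roots Df.
subst f; have {}K_def : K = <<1; y>>%AS by apply: val_inj.
subst K; have p_pr := pcharf_prime chk.
have translate_e H e : additive_fset H -> supplements G H e ->
    exists2 s : gal_of <<1; y>>%AS, s \in 'Gal(<<1; y>> / 1)%g & s y = y + e%:A.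
  move=> addH supp; apply: (translate_gal addG fu_irr fy); apply/supp.
  by exists 0; [exact: addH.1 | exists 1%N; rewrite add0r].
split; first exact: galois_translates addG fy.
split=> [E | H /(hyperplaneP chk addG)[addH sHG cardG]].
  split=> [[sEK dimE] | [H [e [z [/(hyperplaneP chk addG)[addH sHG cardG]]]]]].
    have [H [addH sHG cardG galH]] := subfield_hyperplane addG fu_irr fy sEK dimE.
    have [e supp] := supplement_exists chk addG addH sHG cardG.
    have ASz := artin_schreier_quotient chk addH supp cardG fy.
    exists H, e, ((fH H).[e]^-1 *: (map_poly (in_alg L) (fH H)).[y]); split=> //.
    - exact/(hyperplaneP chk addG).
    - exact/(complement_vectorP chk).
    rewrite (artin_schreier_fixedField chk addG addH supp cardG fu_irr fy ASz).
    rewrite galH; apply/esym/galois_fixedField.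
    by apply: galoisS (galois_translates addG fy); rewrite sub1v.
  move=> /(complement_vectorP chk _ _ addH) supp ASz DE.
  have [s galKs sy] := translate_e H e addH supp.
  rewrite DE; split; first exact (artin_schreier_sub chk addH supp cardG fy ASz).
  exact (dim_artin_schreier chk addG addH supp cardG fu_irr fy ASz galKs sy).
split=> [|e /(complement_vectorP chk _ _ addH) supp].
  have [e supp] := supplement_exists chk addG addH sHG cardG.
  by exists e; apply/(complement_vectorP chk).
split.
  by eexists; exact: (artin_schreier_quotient chk addH supp cardG fy).
move=> z ASz; have [s galKs sy] := translate_e H e addH supp.
split.
- exact (artin_schreier_fixedField chk addG addH supp cardG fu_irr fy ASz).
- exact (artin_schreier_galois chk addG addH supp cardG fu_irr fy ASz).
exists s; split=> //.
  exact (artin_schreier_gal chk addG addH supp cardG fu_irr fy ASz galKs sy).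
exact (gal_artin_schreier_gen chk addH supp cardG fy ASz sy).
Qed.
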